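(* Fix an integer $k \ge 0$ and a real number $0 < \epsilon < 1$, and let $\omega = \omega(n)$ be a function with $\omega(n) \to \infty$ as $n\to\infty$. Suppose $Y = Y_k(n,p)$ is a random $p$-subcomplex of the simplex $\Delta_n$ on $n$ vertices, with $$p \ge \frac{2(k+1)(k+2)\log n + \omega}{\epsilon^2 n}.$$ Then $Y$ asymptotically almost surely (a.a.s., i.e. with probability tending to $1$ as $n \to \infty$) satisfies $$h^k(Y) \ge (1-\epsilon)\, p\, \frac{n}{k+2}.$$ On the other hand, the maximum $k$-degree satisfies $D_k(Y) \approx np$ (that is, it is approximately $np$), so $Y$ is a.a.s. a degree-relative ($k$-coboundary) expander.
   Context: $\Delta_n$ is the $(n-1)$-dimensional simplex on $n$ vertices. The random complex $Y_k(n,p)$ contains all faces of $\Delta_n$ of dimension at most $k$, no faces of dimension greater than $k+1$, and each $(k+1)$-dimensional face of $\Delta_n$ is included independently with probability $p$. For a finite simplicial complex $X$, $X^{(k)}$ denotes the set of $k$-dimensional faces and $C^kX = \{X^{(k)} \to \mathbb{Z}_2\}$ the $\mathbb{Z}_2$-vector space of $k$-cochains. The coboundary $d : C^kX \to C^{k+1}X$ is $d\beta(x) = \sum_{y \in \partial x}\beta(y)$, the sum being over the $k$-faces $y$ in the boundary of the $(k+1)$-face $x$. The reduced (augmented) cochain complex is used: $C^{-1}X = \mathbb{Z}_2$, and $d : C^{-1}X \to C^0X$ sends $1$ to the constant function $1$. Write $B^kX = d(C^{k-1}X)$. The norm $\|\beta\|$ of a cochain is the cardinality of its support, and $\|[\beta]\|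 = \min_{\alpha \in C^{k-1}X}\|\beta + d\alpha\|$. The $k$th coboundary expansion is $$h^k(X) = \min_{\beta \in C^kX \setminus B^kX} \frac{\|d\beta\|}{\|[\beta]\|}.$$ The maximum $k$-degree $D_k(X)$ is the maximum, over $k$-faces of $X$, of the number of $(k+1)$-faces of $X$ containing that $k$-face. A family of complexes $X_n$ is a degree-relative $k$-coboundary expander family if $|X_n^{(k)}| \to \infty$ and there is a constant $c>0$ with $\frac{h^k(X_n)}{D_k(X_n)} \ge c$ for all $n$; for the random complexes $Y$, being a.a.s. a degree-relative expander refers to such a bound, with $c>0$ not depending on $n$, holding a.a.s. *)

(* Defs.v *)
From HB Require Import structures.
From mathcomp Require Import all_boot all_order all_algebra.
From mathcomp Require Import all_classical all_reals all_analysis.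
Import Order.TTheory GRing.Theory Num.Theory.
Import numFieldNormedType.Exports.

Set Implicit Arguments.
Unset Strict Implicit.
Unset Printing Implicit Defensive.

Local Open Scope ring_scope.

(* Throughout, [m] counts vertices: a face with [m] vertices has dimension
   [m - 1], so that dimension -1 is [m = 0]. *)

Record complex (V : finType) := Complex {
  faces :> {set {set V}};
  complex_set0 : finset.set0 \in faces;
  complex_sub : forall x y : {set V}, y \subset x -> x \in faces -> y \in faces
}.

Definition dfaces (V : finType) (X : complex V) (m : nat) : {set {set V}} :=
  finset (fun x : {set V} => (x \in faces X) && (#|x| == m)).

Definition face (V : finType) (X : complex V) (m : nat) : finType :=
  {x : {set V} | x \in dfaces X m}.

(* [cochain X m] is C^(m-1)(X; Z_2). Since the empty set is the only face with
   no vertices, [cochain X 0] is the augmentation term C^(-1) = Z_2. *)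
Notation cochain X m := {ffun face X m -> 'F_2}.

(* For [m = 0] the only summand is the empty face, so this is the augmentation
   sending 1 to the constant function 1. *)
Definition coboundary (V : finType) (X : complex V) (m : nat)
    (b : cochain X m) : cochain X m.+1 :=
  [ffun x : face X m.+1 => \sum_(y : face X m | val y \subset val x) b y].

Definition coboundaries (V : finType) (X : complex V) (m : nat)
    : {set cochain X m.+1} :=
  finset.imset (@coboundary V X m) (mem (finset.setT : {set cochain X m})).

Definition conorm (V : finType) (X : complex V) (m : nat)
    (b : cochain X m) : nat := #|[pred x | b x != 0]|.

(* The default value [conorm b] is the one attained at [a = 0]. *)
Definition class_norm (V : finType) (X : complex V) (m : nat)
    (b : cochain X m.+1) : nat :=
  \big[minn/conorm b]_(a : cochain X m) conorm (b + coboundary a).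

(* h^k(X). The infimum is over a finite set, hence a minimum as soon as
   C^k X <> B^k X; otherwise it takes the value [inf set0 = 0]. *)
Definition expansion (R : realType) (V : finType) (X : complex V) (k : nat) : R :=
  inf [set r : R | exists2 b : cochain X k.+1, b \notin coboundaries X k &
         r = (conorm (coboundary b))%:R / (class_norm b)%:R]%classic.

(* D_k(X) *)
Definition max_degree (V : finType) (X : complex V) (k : nat) : nat :=
  \max_(y in dfaces X k.+1) #|[pred x in dfaces X k.+2 | y \subset x]|.

Definition simplex_faces (n m : nat) : {set {set 'I_n}} :=
  finset (fun x : {set 'I_n} => #|x| == m).

(* The complex with full k-skeleton whose (k+1)-faces are the members of [S]. *)
Definition Yfaces (n k : nat) (S : {set {set 'I_n}}) : {set {set 'I_n}} :=
  finset (fun x : {set 'I_n} =>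
    (#|x| <= k.+1)%N || ((#|x| == k.+2) && (x \in S))).

Lemma Yfaces_set0 n k (S : {set {set 'I_n}}) : finset.set0 \in Yfaces k S.
Proof. by rewrite finset.inE cards0. Qed.

Lemma Yfaces_sub n k (S : {set {set 'I_n}}) (x y : {set 'I_n}) :
  y \subset x -> x \in Yfaces k S -> y \in Yfaces k S.
Proof.
move=> yx; rewrite !finset.inE => /orP[xk|/andP[/eqP xk xS]].
  by rewrite (leq_trans (subset_leq_card yx) xk).
have := subset_leq_card yx; rewrite xk leq_eqVlt => /orP[/eqP yk|]; last first.
  by rewrite ltnS => ->.
have -> : y = x by apply/eqP; rewrite eqEcard yx xk yk /=.
by rewrite xk xS eqxx orbT.
Qed.

Definition Ycomplex (n k : nat) (S : {set {set 'I_n}}) : complex 'I_n :=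
  @Complex 'I_n (Yfaces k S) (@Yfaces_set0 n k S) (@Yfaces_sub n k S).

(* The probability that Y_k(n,p) satisfies [E], under the product Bernoulli
   law on the sets of (k+1)-faces of the simplex. *)
Definition prY (R : realType) (n k : nat) (p : R) (E : complex 'I_n -> bool) : R :=
  \sum_(S in powerset (simplex_faces n k.+2) | E (Ycomplex k S))
    \prod_(x in simplex_faces n k.+2) (if x \in S then p else 1 - p).

Lemma prY_true (R : realType) (n k : nat) (p : R) :
  prY k p (fun _ : complex 'I_n => true) = 1.
Proof.
rewrite /prY; set A := simplex_faces n k.+2.
transitivity (\prod_(x : {set 'I_n})
    ((if x \in A then p else 0) + (if x \in A then 1 - p else 1))).
  rewrite bigA_distr [RHS](bigID (fun S => S \in powerset A)) /=.
  rewrite [X in _ = _ + X]big1 ?addr0 => [|S]; last first.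
    rewrite powersetE => /subsetPn[x xS xA].
    by rewrite (bigD1 x) //= xS (negbTE xA) mul0r.
  apply: eq_big => [S|S]; first by rewrite andbT finset.inE.
  rewrite powersetE andbT => SA.
  rewrite [RHS](bigID (fun x => x \in A)) /= [X in _ = _ * X]big1 ?mulr1.
    by apply: eq_bigr => x ->.
  move=> x xA; rewrite (negbTE xA) ifN //.
  by apply: contra xA => /(fintype.subsetP SA).
by rewrite big1 // => x _; case: ifP => _; rewrite ?add0r // addrC subrK.
Qed.

Definition aas (R : realType) (k : nat) (p : nat -> R)
    (E : forall n, complex 'I_n -> bool) : Prop :=
  ((fun n => prY k (p n) (E n)) @ \oo --> (1 : R))%classic.

Definition aas_degree_relative_expander (R : realType) (k : nat)
    (p : nat -> R) : Prop :=
  (forall M : nat, aas k p (fun n Y => M <= #|dfaces Y k.+1|)%N) /\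
  exists2 c : R, 0 < c &
    aas k p (fun n Y => c <= expansion R Y k / (max_degree Y k)%:R).

(* Main.v *)
(* In the full simplex, coning off a cochain b from a vertex v gives a
   cohomologous cochain supported on the faces t with v |: t in the support of
   d b; summing over v yields n ||[b]|| <= (k+2) ||d b||. In Y, the norm of d b
   is thus binomial with mean at least p n ||b|| / (k+2) when b is minimal in its
   class, and by Chernoff it is below (1 - eps) times that with probability at
   most q^||b||, where q = exp(- eps^2 n p / (2(k+2))). The sum of q^||b|| over
   nonzero cochains is (1 + q)^C(n,k+1) - 1 <= exp(n^(k+1) q) - 1, which tends to 0
   by the choice of p. Degrees are binomial as well: the upper tail is summed over
   all k-faces, while one face suffices for the lower bound. *)
Require Import Defs.
From mathcomp Require Import all_boot all_order all_algebra.
From mathcomp Require Import all_classical all_reals all_analysis.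
From mathcomp Require Import ring lra.
Import Order.TTheory GRing.Theory Num.Theory.
Import numFieldNormedType.Exports.

Set Implicit Arguments.
Unset Strict Implicit.
Unset Printing Implicit Defensive.

Local Open Scope classical_set_scope.
Local Open Scope ring_scope.

(** * Arithmetic modulo 2 *)

Lemma addrr_F2 (a : 'F_2) : a + a = 0.
Proof. by apply: addrr_pchar2; exact: pchar_Fp. Qed.

Lemma F2_nonzero (a : 'F_2) : a = (a != 0)%:R.
Proof. by case: a => [[|[|]]] // i; apply: val_inj. Qed.

Lemma natr_F2_eq0 (m : nat) : ((m%:R : 'F_2) == 0) = ~~ odd m.
Proof.
elim: m => // m IH; rewrite -natr1 /= -IH.
by case: (m%:R : 'F_2) => [[|[|]]] // i.
Qed.

(** * Coboundaries in the full simplex and the cone homotopy *)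

Section FormalCoboundary.
Import mathcomp.boot.finset.
Variable V : finType.
Implicit Types (f : {set V} -> 'F_2) (x y z w : {set V}).

(** Acts on functions of all subsets, so that it makes sense on simplices missing from a complex. *)
Definition formal_coboundary (m : nat) f x : 'F_2 :=
  \sum_(y : {set V} | (#|y| == m) && (y \subset x)) f y.

(** The sets counted are the [v |: z] with [v] in [w :\: z]. This serves both for [d d = 0] and for
    counting the cofaces of a face. *)
Lemma card_between z w : z \subset w ->
  #|finset (fun y => [&& #|y| == #|z|.+1, z \subset y & y \subset w])|
  = #|w :\: z|.
Proof.
move=> zw.
have -> : finset (fun y => [&& #|y| == #|z|.+1, z \subset y & y \subset w])
    = finset.imset (fun v => v |: z) (mem (w :\: z)).
  apply/setP => y; rewrite !finset.inE; apply/idP/idP => [/and3P[/eqP cy zy yw]|].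
    have /cards1P[v yv] : #|y :\: z| == 1%N.
      by rewrite cardsD (setIidPr zy) cy subSnn.
    have : v \in y :\: z by rewrite yv finset.inE.
    rewrite finset.inE => /andP[vz vy].
    apply/imsetP; exists v; first by rewrite finset.inE vz (fintype.subsetP yw).
    by rewrite -yv finset.setUC -[LHS](setID y z) (setIidPr zy).
  move=> /imsetP[v]; rewrite !finset.inE => /andP[vz vw] ->.
  by rewrite cardsU1 vz finset.subsetUr subUset zw sub1set vw eqxx.
rewrite card_in_imset // => u v; rewrite !finset.inE => /andP[uz _] /andP[vz _] e.
have : u \in v |: z by rewrite -e setU11.
by rewrite !finset.inE (negbTE uz) orbF => /eqP.
Qed.

(** Each [z] of size [m] in [x] lies in exactly two facets of [x], so its contributions cancel
    modulo 2. *)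
Lemma formal_coboundaryK (m : nat) f x : #|x| = m.+2 ->
  formal_coboundary m.+1 (formal_coboundary m f) x = 0.
Proof.
move=> cx; rewrite /formal_coboundary.
rewrite (exchange_big_dep (fun z => (#|z| == m) && (z \subset x))) /=; last first.
  by move=> y z /andP[_ yx] /andP[-> zy]; rewrite (fintype.subset_trans zy yx).
apply: big1 => z /andP[/eqP cz zx].
rewrite sumr_const -[X in _ *+ X](_ : 2%N = _) ?mulr2n ?addrr_F2 //.
have <- : #|x :\: z| = 2%N by rewrite cardsD (setIidPr zx) cx cz subSn // subSnn.
rewrite -(card_between zx) cardsE; apply: eq_card => y; rewrite !unfold_in /= cz.
by rewrite eqxx -andbA; congr andb; rewrite [RHS]andbC.
Qed.

Lemma formal_coboundaryD (m : nat) f g x :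
  formal_coboundary m (fun y => f y + g y) x
  = formal_coboundary m f x + formal_coboundary m g x.
Proof. exact: big_split. Qed.

Definition cone (v : V) f (z : {set V}) : 'F_2 := if v \in z then 0 else f (v |: z).

(** The homotopy identity [id + d c = c d] for the cone operator [c] from [v]. If [v] is in [x],
    only the facet [x :\ v] contributes to [d c], and it gives [f x]. Otherwise the facets of
    [v |: x] are [x] itself and the [v |: y] over the facets [y] of [x]. *)
Lemma cone_homotopy (k : nat) (v : V) f x : #|x| = k.+1 ->
  f x + formal_coboundary k (cone v f) x
  = if v \in x then 0 else formal_coboundary k.+1 f (v |: x).
Proof.
move=> cx; case: ifPn => vx.
  rewrite /formal_coboundary (bigD1 (x :\ v)) /=; last first.
    by rewrite subD1set andbT -eqSS -cx (cardsD1 v x) vx eqxx.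
  rewrite big1 => [|y /andP[/andP[/eqP cy yx] yne]].
    by rewrite /cone setD11 setD1K // addr0 addrr_F2.
  rewrite /cone; case: ifPn => // vy; case/eqP: yne.
  apply/eqP; rewrite eqEcard cy subsetD1 yx vy /=.
  by have := cardsD1 v x; rewrite vx cx add1n => -[<-].
rewrite /formal_coboundary [RHS](bigID (fun y : {set V} => v \in y)) /= (addrC (f x)).
congr (_ + _).
  rewrite [RHS](reindex_onto (fun z => v |: z) (fun y => y :\ v)) /=; last first.
    by move=> y /andP[_ vy]; rewrite setD1K.
  apply: eq_big => [y|y /andP[_ yx]]; last first.
    by rewrite /cone ifN //; apply: contra vx => /(fintype.subsetP yx).
  rewrite setU11 andbT; apply/idP/idP => [/andP[/eqP cy yx]|].
    have vy : v \notin y by apply: contra vx => /(fintype.subsetP yx).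
    by rewrite cardsU1 vy cy eqxx setUS //= setU1K.
  move=> /andP[/andP[cy yx] /eqP e].
  have vy : v \notin y by rewrite -e setD11.
  move: cy; rewrite cardsU1 vy eqSS => -> /=.
  apply/fintype.subsetP => u uy.
  have /(fintype.subsetP yx) : u \in v |: y by rewrite setU1r.
  by rewrite !inE => /orP[/eqP ue|//]; rewrite -ue uy in vy.
rewrite (bigD1 x) /= ?cx ?eqxx ?finset.subsetUr //= big1 ?addr0 // => y.
move=> /andP[/andP[/andP[/eqP cy yx] vy] /eqP []]; apply/eqP.
rewrite eqEcard cx cy leqnn andbT; apply/fintype.subsetP => u uy.
have := fintype.subsetP yx _ uy; rewrite !inE => /orP[/eqP ue|//].
by rewrite -ue uy in vy.
Qed.
End FormalCoboundary.

(** * Coboundary expansion of complexes with full skeleton *)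

Section Expansion.
Import mathcomp.boot.finset.
Variables (V : finType) (X : complex V).

(** Extension by zero, which moves cochains of all complexes on [V] into one type. *)
Definition cochain_ext (m : nat) (b : cochain X m) (x : {set V}) : 'F_2 :=
  oapp b 0 (insub x).

Lemma cochain_ext_val m (b : cochain X m) (u : face X m) :
  cochain_ext b (val u) = b u.
Proof. by rewrite /cochain_ext valK. Qed.

Lemma cochain_extD m (b c : cochain X m) x :
  cochain_ext (b + c) x = cochain_ext b x + cochain_ext c x.
Proof.
rewrite /cochain_ext; case: insubP => [u _ _|_] /=; first by rewrite ffunE.
by rewrite addr0.
Qed.

Lemma cochain_ext_out m (b : cochain X m) x :
  x \notin dfaces X m -> cochain_ext b x = 0.
Proof. by move=> xX; rewrite /cochain_ext insubN. Qed.

Lemma dfacesE m x : (x \in dfaces X m) = (x \in faces X) && (#|x| == m).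
Proof. by rewrite finset.inE. Qed.

Lemma card_dface m (u : face X m) : #|val u| = m.
Proof. by have := valP u; rewrite dfacesE => /andP[_ /eqP]. Qed.

Lemma dface_val m x : x \in dfaces X m -> exists u : face X m, val u = x.
Proof. by move=> xX; exists (exist _ x xX). Qed.

Lemma coboundaryE m (b : cochain X m) (x : face X m.+1) :
  coboundary b x = formal_coboundary m (cochain_ext b) (val x).
Proof.
rewrite ffunE /formal_coboundary.
rewrite [RHS](bigID (fun y => y \in dfaces X m)) /= [X in _ = _ + X]big1 ?addr0.
  rewrite [RHS](reindex_omap (val : face X m -> {set V}) insub) /=.
    apply: eq_big => [y|y _]; last by rewrite cochain_ext_val.
    by rewrite valK eqxx andbT (valP y) andbT card_dface eqxx.
  by move=> y /andP[_ yX]; rewrite insubT.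
by move=> y /andP[_ yX]; rewrite cochain_ext_out.
Qed.

Lemma card_face m (P : pred {set V}) :
  #|[pred u : face X m | P (val u)]|
  = #|finset (fun x => (x \in dfaces X m) && P x)|.
Proof.
rewrite -(card_imset _ val_inj); apply: eq_card => x; rewrite [RHS]finset.inE.
apply/imsetP/andP => [[u Pu ->]|[xX Px]]; first by split; [exact: valP|].
by have [u ux] := dface_val xX; exists u; rewrite // unfold_in /= ux.
Qed.

Lemma conormE m (b : cochain X m) :
  conorm b = #|finset (fun x => cochain_ext b x != 0)|.
Proof.
transitivity #|[pred u : face X m | cochain_ext b (val u) != 0]|.
  by apply: eq_card => u; rewrite !unfold_in /= cochain_ext_val.
rewrite (card_face m (fun x => cochain_ext b x != 0)).
apply: eq_card => x; rewrite !finset.inE -dfacesE.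
by case: (boolP (x \in _)) => //= /(cochain_ext_out b) ->; rewrite eqxx.
Qed.

Lemma conorm_coboundary m (b : cochain X m) :
  conorm (coboundary b) = #|finset (fun x => (x \in dfaces X m.+1) &&
     (formal_coboundary m (cochain_ext b) x != 0))|.
Proof.
rewrite -(card_face _ (fun x => formal_coboundary m (cochain_ext b) x != 0)).
apply: eq_card => u.
by rewrite !unfold_in /= coboundaryE.
Qed.

Lemma class_norm_le m (b : cochain X m.+1) (a : cochain X m) :
  (class_norm b <= conorm (b + coboundary a)%R)%N.
Proof.
rewrite /class_norm; elim: index_enum (mem_index_enum a) => // c s IH.
rewrite inE big_cons geq_min => /orP[/eqP <-|/IH ->]; first by rewrite leqnn.
exact: orbT.
Qed.

Lemma class_norm_attained m (b : cochain X m.+1) :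
  exists a, class_norm b = conorm (b + coboundary a).
Proof.
rewrite /class_norm.
apply: (big_ind (fun s => exists a, s = conorm (b + coboundary a)))
  => [|s t [a ->] [c ->]|a _]; last by exists a.
  exists 0; congr conorm; apply/ffunP => u; rewrite ffunE.
  suff -> : coboundary 0 u = 0 by rewrite addr0.
  by rewrite ffunE; apply: big1 => y _; rewrite ffunE.
by rewrite /minn; case: ifP; [exists a|exists c].
Qed.

Variable k : nat.
Hypothesis full_skeleton : forall x : {set V}, (#|x| <= k.+1)%N -> x \in faces X.

Lemma mem_dfaces_skeleton m (x : {set V}) : (m <= k.+1)%N ->
  (x \in dfaces X m) = (#|x| == m).
Proof.
move=> mk; rewrite dfacesE; case: eqP => [cx|]; last by rewrite andbF.
by rewrite full_skeleton ?cx.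
Qed.

Lemma cochain_ext_coboundary (a : cochain X k) (x : {set V}) : #|x| = k.+1 ->
  cochain_ext (coboundary a) x = formal_coboundary k (cochain_ext a) x.
Proof.
move=> /eqP; rewrite -mem_dfaces_skeleton // => xX.
by have [u <-] := dface_val xX; rewrite cochain_ext_val coboundaryE.
Qed.

(** The full skeleton makes extension by zero commute with [d] in this degree, so [d d = 0] applies
    even when [x] is not a face of [X]. *)
Lemma formal_coboundary_coboundary (b : cochain X k.+1)
    (a : cochain X k) (x : {set V}) :
  #|x| = k.+2 ->
  formal_coboundary k.+1 (cochain_ext (b + coboundary a)) x
  = formal_coboundary k.+1 (cochain_ext b) x.
Proof.
move=> cx; rewrite -[RHS]addr0 -(formal_coboundaryK (cochain_ext a) cx).
rewrite -formal_coboundaryD; apply: eq_bigr => y /andP[/eqP cy _].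
by rewrite cochain_extD cochain_ext_coboundary.
Qed.

(** Simplices outside [X] are included, so the set depends on the values of [b] and not on the
    [(k+1)]-faces of [X]. *)
Definition simplex_support (b : cochain X k.+1) : {set {set V}} :=
  finset (fun x : {set V} => (#|x| == k.+2) &&
    (formal_coboundary k.+1 (cochain_ext b) x != 0)).

(* Coning off [b] from [v] exhibits a representative of its class supported on
   the faces [t] such that [d b] is nonzero on [v |: t]. *)
Lemma class_norm_link (b : cochain X k.+1) (v : V) :
  (class_norm b <= #|[pred x in simplex_support b | v \in x]|)%N.
Proof.
pose c : cochain X k := [ffun s => cone v (cochain_ext b) (val s)].
have cE (s : {set V}) : #|s| = k -> cochain_ext c s = cone v (cochain_ext b) s.
  move=> /eqP; rewrite -mem_dfaces_skeleton // => sX.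
  by have [u <-] := dface_val sX; rewrite cochain_ext_val ffunE.
have bcE (u : face X k.+1) : (b + coboundary c) u = if v \in val u then 0
    else formal_coboundary k.+1 (cochain_ext b) (v |: val u).
  rewrite -(cone_homotopy v _ (card_dface u)) ffunE cochain_ext_val coboundaryE.
  by congr (_ + _); apply: eq_bigr => y /andP[/eqP cy _]; rewrite cE.
apply: leq_trans (class_norm_le b c) _.
have inj : {in [pred u | (b + coboundary c) u != 0] &,
    injective (fun u : face X k.+1 => v |: val u)}.
  move=> u w; rewrite !unfold_in /= !bcE.
  case: ifPn => [_|vu _]; first by rewrite eqxx.
  case: ifPn => [_|vw _ e]; first by rewrite eqxx.
  by apply: val_inj; rewrite -(setU1K vu) e setU1K.
rewrite /conorm -(card_in_imset inj); apply: subset_leq_card.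
apply/fintype.subsetP => x /imsetP[u]; rewrite !unfold_in /= bcE.
case: ifPn => [_|vu bu ->]; first by rewrite eqxx.
apply/andP; split; last exact: setU11.
suff: v |: val u \in simplex_support b by [].
by rewrite finset.inE bu cardsU1 vu card_dface eqxx.
Qed.

(** Summing [class_norm_link] over [v] counts each member of the support once for each of its [k.+2]
    vertices. *)
Lemma class_norm_simplex (b : cochain X k.+1) :
  (#|V| * class_norm b <= k.+2 * #|simplex_support b|)%N.
Proof.
rewrite -sum_nat_const; apply: (@leq_trans
    (\sum_(v : V) \sum_(x in simplex_support b) (v \in x))%N).
  apply: leq_sum => v _; apply: leq_trans (class_norm_link b v) _.
  by rewrite -sum1_card big_mkcondr.
rewrite exchange_big /= mulnC -sum_nat_const; apply: leq_sum => x.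
rewrite finset.inE => /andP[/eqP <- _].
by rewrite -sum1_card [X in (_ <= X)%N]big_mkcond.
Qed.

(** The indicator of a facet [x :\ v] of some [(k+1)]-simplex [x] works: its coboundary at [x] is 1,
    whereas [d d = 0] would force 0. *)
Lemma coboundaries_proper : (k.+2 <= #|V|)%N ->
  exists b : cochain X k.+1, b \notin coboundaries X k.
Proof.
rewrite -bin_gt0 -card_draws => /card_gt0P[x]; rewrite finset.inE => /eqP cx.
have /card_gt0P[v vx] : (0 < #|x|)%N by rewrite cx.
have cxv : #|x :\ v| = k.+1 by move: cx; rewrite (cardsD1 v) vx add1n => -[].
exists [ffun u => (val u == x :\ v)%:R]; apply/negP => /imsetP[a _ e].
have := formal_coboundaryK (cochain_ext a) cx.
rewrite /formal_coboundary (bigD1 (x :\ v)) /=; last by rewrite cxv eqxx subD1set.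
have dE (y : {set V}) : #|y| = k.+1 ->
    formal_coboundary k (cochain_ext a) y = (y == x :\ v)%:R.
  move=> cy; rewrite -cochain_ext_coboundary // -e.
  have yX : y \in dfaces X k.+1 by rewrite mem_dfaces_skeleton ?cy.
  by have [u <-] := dface_val yX; rewrite cochain_ext_val ffunE.
rewrite [X in X + _]dE // eqxx big1 ?addr0 // => y /andP[/andP[/eqP cy _] /negbTE ny].
by rewrite [LHS]dE // ny.
Qed.

(** It suffices to test minimal representatives. Minimality is kept only as a size inequality on
    supports, which can index a union bound. *)
Lemma expansion_ge (R : realType) (t : R) : (k.+2 <= #|V|)%N ->
  (forall b : cochain X k.+1, (0 < conorm b)%N ->
     (#|V| * conorm b <= k.+2 * #|simplex_support b|)%N ->
     t * (conorm b)%:R <= (conorm (coboundary b))%:R) ->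
  t <= expansion R X k.
Proof.
move=> Vk H; apply: lb_le_inf.
  (* The set must be nonempty, since otherwise [inf] takes its default value 0. *)
  by have [b bB] := coboundaries_proper Vk; eexists; exists b.
move=> _ [b bB ->]; have [a ba] := class_norm_attained b.
have dba (x : {set V}) : #|x| = k.+2 ->
    formal_coboundary k.+1 (cochain_ext (b + coboundary a)) x
    = formal_coboundary k.+1 (cochain_ext b) x.
  exact: formal_coboundary_coboundary.
have nz : (0 < conorm (b + coboundary a)%R)%N.
  rewrite lt0n; apply: contra bB => /eqP/card0_eq b0.
  apply/imsetP; exists a => //; apply/ffunP => u; apply/eqP.
  have /negbFE/eqP := b0 u; rewrite ffunE => /eqP.
  by rewrite addr_eq0 -[- _]add0r -(addrr_F2 (coboundary a u)) addrK.
rewrite ba ler_pdivlMr ?ltr0n //.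
(* The minimal representative replaces [b]: both [d b] and [simplex_support b] are class invariants,
   so [class_norm_simplex] gives its size inequality. *)
suff -> : conorm (coboundary b) = conorm (coboundary (b + coboundary a)).
  apply: H => //; rewrite -ba; have := class_norm_simplex b.
  congr (_ <= _ * _)%N; apply: eq_card => x; rewrite !finset.inE.
  by case: eqP => // /dba ->.
rewrite !conorm_coboundary; apply: eq_card => x; rewrite !finset.inE.
by case: eqP => [/dba ->//|]; rewrite andbF.
Qed.
End Expansion.

(** * Bernoulli measures on finite sets: union and Chernoff bounds *)

Section Bernoulli.
Import mathcomp.boot.finset.
Variables (R : realType) (T : finType) (A : {set T}).
Implicit Types (S B : {set T}) (E : {set T} -> bool).

Lemma sum_powerset_prod (F G : T -> R) :
  \sum_(S in powerset A) \prod_(x in A) (if x \in S then F x else G x)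
  = \prod_(x in A) (F x + G x).
Proof.
(* Factors outside [A] are written [0 + 1], so that distributing over all of [T] keeps only the
   subsets of [A]. *)
transitivity (\prod_(x : T)
    ((if x \in A then F x else 0) + (if x \in A then G x else 1))).
  rewrite bigA_distr [RHS](bigID (fun S => S \in powerset A)) /=.
  rewrite [X in _ = _ + X]big1 ?addr0 => [|S]; last first.
    rewrite powersetE => /subsetPn[x xS xA].
    by rewrite (bigD1 x) //= xS (negbTE xA) mul0r.
  apply: eq_bigr => S; rewrite powersetE => SA.
  rewrite [RHS](bigID (fun x => x \in A)) /= [X in _ = _ * X]big1 ?mulr1.
    by apply: eq_bigr => x ->.
  move=> x xA; rewrite (negbTE xA) ifN //.
  by apply: contra xA => /(fintype.subsetP SA).
by rewrite [RHS]big_mkcond; apply: eq_bigr => x _; case: ifP => //; rewrite add0r.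
Qed.

Lemma prod_if_subset (c : R) B : B \subset A ->
  \prod_(x in A) (if x \in B then c else 1) = c ^+ #|B|.
Proof.
move=> BA; rewrite -big_mkcondr -prodr_const; apply: eq_bigl => x.
by rewrite andbC; case: (boolP (x \in B)) => //= /(fintype.subsetP BA).
Qed.

(** The binomial theorem without the term of the empty set. *)
Lemma sum_nonempty_expr (q : R) :
  \sum_(B in powerset A | B != set0) q ^+ #|B| = (1 + q) ^+ #|A| - 1.
Proof.
rewrite -prodr_const (addrC 1 q) -sum_powerset_prod.
rewrite [X in _ = X - 1](bigD1 set0) ?powersetE ?sub0set //=.
rewrite [X in _ = X + _ - 1]big1 => [|x _]; last by rewrite inE.
rewrite addrAC subrr add0r; apply: eq_bigr => B; rewrite powersetE => /andP[BA _].
by rewrite prod_if_subset.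
Qed.

Variable p : R.
Hypothesis p01 : 0 <= p <= 1.

Definition bernoulli_weight S : R := \prod_(x in A) (if x \in S then p else 1 - p).

Definition bernoulli_pr E : R := \sum_(S in powerset A | E S) bernoulli_weight S.

Lemma bernoulli_weight_ge0 S : 0 <= bernoulli_weight S.
Proof.
case/andP: p01 => p0 p1; apply: prodr_ge0 => x _.
by case: ifP; rewrite ?subr_ge0.
Qed.

Lemma bernoulli_pr_ge0 E : 0 <= bernoulli_pr E.
Proof. by apply: sumr_ge0 => S _; exact: bernoulli_weight_ge0. Qed.

Lemma bernoulli_prC E : bernoulli_pr E = 1 - bernoulli_pr (fun S => ~~ E S).
Proof.
apply/eqP; rewrite eq_sym subr_eq eq_sym -(bigID E) /=.
by rewrite sum_powerset_prod big1 // => x _; rewrite addrC subrK.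
Qed.

(** Markov's inequality: [Z] dominates the indicator of [E]. *)
Lemma bernoulli_pr_le_expectation E (Z : {set T} -> R) :
  (forall S, 0 <= Z S) -> (forall S, S \subset A -> E S -> 1 <= Z S) ->
  bernoulli_pr E <= \sum_(S in powerset A) bernoulli_weight S * Z S.
Proof.
move=> Z0 Z1; rewrite /bernoulli_pr big_mkcondr; apply: ler_sum => S.
rewrite powersetE => SA; have w0 := bernoulli_weight_ge0 S.
by case: ifPn => [/Z1 ZS|_]; [rewrite ler_peMr // ZS|rewrite mulr_ge0].
Qed.

(** Union bound, by Markov applied to the number of events [E i] that occur. *)
Lemma bernoulli_pr_bigcup (I : finType) (P : pred I) (E : I -> {set T} -> bool) E0 :
  (forall S, S \subset A -> E0 S -> exists2 i, P i & E i S) ->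
  bernoulli_pr E0 <= \sum_(i | P i) bernoulli_pr (E i).
Proof.
move=> E0E; apply: le_trans (bernoulli_pr_le_expectation
  (Z := fun S => \sum_(i | P i) (E i S)%:R) _ _) _.
- by move=> S; apply: sumr_ge0.
- move=> S SA /(E0E _ SA)[i Pi EiS]; rewrite (bigD1 i) //= EiS lerDl.
  exact: sumr_ge0.
under eq_bigr do rewrite mulr_sumr.
rewrite exchange_big /=; apply: ler_sum => i _.
rewrite /bernoulli_pr [leRHS]big_mkcondr; apply: ler_sum => S _.
by case: (E i S); rewrite ?mulr1 ?mulr0.
Qed.

(** Exponential Markov inequality, then [1 + x <= expR x]. Keeping the factor [l] inside the event
    covers the upper tail for [l > 0] and the lower tail for [l < 0]. *)
Lemma bernoulli_pr_chernoff (F : {set T}) (l s : R) : F \subset A ->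
  bernoulli_pr (fun S => l * s <= l * #|S :&: F|%:R)
  <= expR (#|F|%:R * (p * (expR l - 1)) - l * s).
Proof.
move=> FA; apply: le_trans (bernoulli_pr_le_expectation
  (Z := fun S => expR (l * #|S :&: F|%:R) * expR (- (l * s))) _ _) _.
- by move=> S; rewrite mulr_ge0 ?expR_ge0.
- by move=> S _ ls; rewrite -expRD -[leLHS]expR0 ler_expR subr_ge0.
under eq_bigr do rewrite mulrA.
rewrite -mulr_suml expRD ler_wpM2r ?expR_ge0 //.
have -> : \sum_(S in powerset A) bernoulli_weight S * expR (l * #|S :&: F|%:R)
    = \prod_(x in A) (p * (if x \in F then expR l else 1) + (1 - p)).
  rewrite -sum_powerset_prod; apply: eq_bigr => S; rewrite powersetE => SA.
  rewrite expRM_natr -(prod_if_subset _ (_ : S :&: F \subset A)); last first.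
    exact: fintype.subset_trans (subsetIl _ _) SA.
  rewrite -big_split; apply: eq_bigr => x _ /=; rewrite finset.inE.
  by case: (x \in S); rewrite ?mulr1.
have -> : \prod_(x in A) (p * (if x \in F then expR l else 1) + (1 - p))
    = (1 + p * (expR l - 1)) ^+ #|F|.
  rewrite -(prod_if_subset _ FA); apply: eq_bigr => x _.
  by case: ifP => _; ring.
(* Comparing powers needs a nonnegative base, hence the rewriting as a convex combination of 1 and
   [expR l]. *)
rewrite expRM_natl lerXn2r ?nnegrE ?expR_ge0 ?expR_ge1Dx //.
have -> : 1 + p * (expR l - 1) = 1 - p + p * expR l by ring.
by case/andP: p01 => p0 p1; rewrite addr_ge0 ?subr_ge0 // mulr_ge0 ?expR_ge0.
Qed.
End Bernoulli.

(** * Quadratic bounds for the exponential *)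

Section ExpBounds.
Variable R : realType.
Implicit Type x : R.

(** Mean value theorem: the difference has the nonnegative derivative [expR t - (1 + t)]. *)
Lemma expR_ge_quadratic x : 0 <= x -> 1 + x + x ^+ 2 / 2 <= expR x.
Proof.
rewrite le_eqVlt => /orP[/eqP <-|x0]; first by rewrite expR0 expr0n mul0r !addr0.
pose g (t : R) := expR t - (1 + t + t ^+ 2 / 2).
have dg (t : R) : is_derive t 1 g (expR t - (1 + t)).
  apply: is_deriveB; apply: is_derive_eq.
  by rewrite add0r !scaler1 /GRing.scale /=; field.
have cg : {within `[0, x], continuous g}.
  apply: derivable_within_continuous => t _; exact: ex_derive.
have [c _ gc] := MVT x0 (fun t _ => dg t) cg.
rewrite -subr_ge0 -/(g x) -[g x]subr0 -[X in _ - X](_ : g 0 = 0).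
  by rewrite gc subr0 mulr_ge0 ?(ltW x0) // subr_ge0 expR_ge1Dx.
by rewrite /g expR0 expr0n mul0r !addr0 subrr.
Qed.

(** Inverts the previous bound, as [(1 - x + x^2/2) (1 + x + x^2/2) = 1 + x^4/4]. *)
Lemma expRN_le_quadratic x : 0 <= x -> expR (- x) <= 1 - x + x ^+ 2 / 2.
Proof.
move=> x0; rewrite expRN -div1r ler_pdivrMr ?expR_gt0 //.
apply: le_trans (ler_wpM2l _ (expR_ge_quadratic x0)); last by nra.
by have := sqr_ge0 (x ^+ 2); nra.
Qed.

(** Inverts [(1 - x/3)^3 <= expR (- x)]. The cruder [(1 - x/2)^2] would not suffice at [x = 1/2]. *)
Lemma expR_le_quadratic x : 0 <= x <= 2^-1 -> expR x <= 1 + x + x ^+ 2.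
Proof.
move=> /andP[x0 x1].
have y0 : 0 <= 1 - x / 3 by lra.
have : (1 - x / 3) ^+ 3 <= expR (- x).
  have -> : - x = 3%:R * (- (x / 3)) by field.
  by rewrite expRM_natl lerXn2r ?nnegrE ?expR_ge0 // expR_ge1Dx.
rewrite expRN => yx.
rewrite -[leLHS]invrK -[leRHS]invrK lef_pV2 ?posrE ?invr_gt0 ?expR_gt0 //; last by nra.
apply: le_trans yx.
rewrite -div1r ler_pdivrMr; last by nra.
have -> : (1 - x / 3) ^+ 3 * (1 + x + x ^+ 2)
    = 1 + x ^+ 2 * (3^-1 - x * (19 / 27) + x ^+ 2 * (8 / 27) - x ^+ 3 / 27).
  by field.
rewrite lerDl mulr_ge0 ?sqr_ge0 //.
nra.
Qed.
End ExpBounds.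

(** * Failure probabilities for the random complex *)

Section RandomComplex.
Import mathcomp.boot.finset.
Variables (R : realType) (n k : nat).
Implicit Types (S B : {set {set 'I_n}}) (x y : {set 'I_n}).

Lemma prYE (p : R) (E : complex 'I_n -> bool) :
  prY k p E = bernoulli_pr (simplex_faces n k.+2) p (fun S => E (Ycomplex k S)).
Proof. by []. Qed.

Lemma card_simplex_faces m : #|simplex_faces n m| = 'C(n, m).
Proof. by rewrite card_draws card_ord. Qed.

Lemma Ycomplex_skeleton S x : (#|x| <= k.+1)%N -> x \in faces (Ycomplex k S).
Proof. by move=> xk; rewrite inE xk. Qed.

Lemma dfaces_Ycomplex_skeleton S :
  dfaces (Ycomplex k S) k.+1 = simplex_faces n k.+1.
Proof.
apply/setP => x; rewrite (mem_dfaces_skeleton (@Ycomplex_skeleton S)) //.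
by rewrite inE.
Qed.

Lemma dfaces_Ycomplex_top S x :
  (x \in dfaces (Ycomplex k S) k.+2) = (#|x| == k.+2) && (x \in S).
Proof.
rewrite dfacesE inE; case: eqP => [->|]; last by rewrite !andbF.
by rewrite ltnn andbT.
Qed.

(** The support of [d b] in the full simplex when [b] is identified with its support [B]. *)
Definition odd_cofaces B : {set {set 'I_n}} :=
  finset (fun x => (#|x| == k.+2) &&
    odd #|finset (fun y => (y \in B) && (y \subset x))|).

Section Cochain.
Variables (S : {set {set 'I_n}}) (b : cochain (Ycomplex k S) k.+1).
Let B := finset (fun x => cochain_ext b x != 0).

Lemma cochain_support_sub : B \subset simplex_faces n k.+1.
Proof.
apply/fintype.subsetP => x; rewrite inE -(dfaces_Ycomplex_skeleton S) => bx.
by apply: contraNT bx => /(cochain_ext_out b) ->.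
Qed.

Lemma formal_coboundary_support x :
  (formal_coboundary k.+1 (cochain_ext b) x != 0)
  = odd #|finset (fun y => (y \in B) && (y \subset x))|.
Proof.
rewrite -[RHS]negbK -natr_F2_eq0; congr (~~ (_ == 0)).
rewrite -sum1_card natr_sum [RHS](eq_bigl
  (fun y => ((#|y| == k.+1) && (y \subset x)) && (y \in B))); last first.
  move=> y; rewrite !inE andbC; case: (boolP (_ != 0)) => yB; rewrite ?andbF //=.
  have /(fintype.subsetP cochain_support_sub) : y \in B by rewrite inE.
  by rewrite inE => ->.
rewrite big_mkcondr; apply: eq_bigr => y _.
by rewrite [LHS]F2_nonzero inE; case: (_ != 0).
Qed.

Lemma simplex_support_odd : simplex_support b = odd_cofaces B.
Proof. by apply/setP => x; rewrite !inE formal_coboundary_support. Qed.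

Lemma conorm_coboundary_odd : conorm (coboundary b) = #|S :&: odd_cofaces B|.
Proof.
rewrite conorm_coboundary; apply: eq_card => x.
rewrite in_set dfaces_Ycomplex_top !inE formal_coboundary_support.
by case: (x \in S); rewrite ?andbT ?andbF.
Qed.
End Cochain.

Variables (p eps : R).
Hypotheses (p01 : 0 <= p <= 1) (eps01 : 0 < eps < 1).

(** The Chernoff exponent at [l = - eps], for [N] trials. Since
    [expR (- eps) - 1 <= eps^2/2 - eps <= 0], lowering [N] to [m] only weakens the bound, and
    [eps^2/2 - eps + eps (1 - eps) = - eps^2/2]. *)
Lemma expR_lower_tail (N m : R) : 0 <= m <= N ->
  expR (N * (p * (expR (- eps) - 1)) - (- eps) * ((1 - eps) * p * m))
  <= expR (- (eps ^+ 2 * (m * p) / 2)).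
Proof.
move=> /andP[m0 mN]; case/andP: p01 => p0 p1; case/andP: eps01 => e0 e1.
rewrite ler_expR; have := expRN_le_quadratic (ltW e0).
set e := expR _ => ee.
have c0 : eps ^+ 2 / 2 - eps <= 0 by nra.
have : N * p * (e - 1) <= m * p * (eps ^+ 2 / 2 - eps).
  apply: (@le_trans _ _ (N * p * (eps ^+ 2 / 2 - eps))).
    by apply: ler_wpM2l; [apply: mulr_ge0 => //; exact: le_trans mN|lra].
  by apply: ler_wnM2r => //; exact: ler_wpM2r.
lra.
Qed.

Lemma prY_small_expansion : (k.+2 <= n)%N ->
  prY k p (fun Y : complex 'I_n =>
    ~~ ((1 - eps) * p * (n%:R / k.+2%:R) <= expansion R Y k))
  <= expR ('C(n, k.+1)%:R * expR (- (eps ^+ 2 * (n%:R * p) / (2 * k.+2%:R)))) - 1.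
Proof.
move=> kn; set q := expR (- _); pose t := (1 - eps) * p * (n%:R / k.+2%:R).
case/andP: eps01 => e0 e1.
(* The union runs over supports because the type of cochains depends on [S]; the last condition on
   [B] is the size inequality of [expansion_ge]. *)
rewrite prYE; apply: le_trans (bernoulli_pr_bigcup p01
  (P := fun B => [&& B \in powerset (simplex_faces n k.+1), B != set0 &
                     (n * #|B| <= k.+2 * #|odd_cofaces B|)%N])
  (E := fun B S => (- eps) * (t * #|B|%:R) <= (- eps) * #|S :&: odd_cofaces B|%:R) _) _.
  move=> S SA Sh; apply: contrapT => noB; case/negP: Sh.
  apply: expansion_ge; rewrite ?card_ord //; first exact: Ycomplex_skeleton.
  move=> b; rewrite simplex_support_odd conorm_coboundary_odd conormE.
  set B := finset _ => B0 nB; rewrite leNgt; apply/negP => lt_t; apply: noB.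
  exists B; last by rewrite ler_nM2l ?oppr_lt0 // ltW.
  by rewrite powersetE cochain_support_sub -card_gt0 B0 nB.
(* Dropping the size inequality adds nonnegative terms and leaves a binomial sum. *)
apply: (@le_trans _ _
    (\sum_(B in powerset (simplex_faces n k.+1) | B != set0) q ^+ #|B|)); last first.
  rewrite sum_nonempty_expr card_simplex_faces lerD2r expRM_natl.
  by rewrite lerXn2r ?nnegrE ?expR_ge0 ?addr_ge0 ?expR_ge0 // expR_ge1Dx.
rewrite [leRHS](bigID (fun B => n * #|B| <= k.+2 * #|odd_cofaces B|)%N) /=.
rewrite -[leLHS]addr0; apply: lerD; last first.
  by apply: sumr_ge0 => B _; rewrite exprn_ge0 ?expR_ge0.
under eq_bigl do rewrite andbA.
apply: ler_sum => B /andP[_ nB].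
apply: le_trans (bernoulli_pr_chernoff p01 _ _ _) _.
  by apply/fintype.subsetP => x; rewrite !inE => /andP[].
have -> : t * #|B|%:R = (1 - eps) * p * (n%:R / k.+2%:R * #|B|%:R).
  by rewrite /t; ring.
(* The size inequality bounds [m = n / (k+2) * #|B|] by the number [N] of trials. *)
apply: le_trans (expR_lower_tail _) _.
  rewrite mulr_ge0 ?divr_ge0 //= mulrAC ler_pdivrMr ?ltr0n // mulrC.
  by rewrite (mulrC _ k.+2%:R) -!natrM ler_nat (mulnC _ n).
rewrite -expRM_natl ler_expR le_eqVlt; apply/orP; left; apply/eqP.
have : k.+2%:R != 0 :> R by rewrite pnatr_eq0.
by move: (k.+2%:R : R) => a a0; field.
Qed.

Definition cofaces y : {set {set 'I_n}} :=
  finset (fun x => (#|x| == k.+2) && (y \subset x)).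

Lemma cofaces_sub y : cofaces y \subset simplex_faces n k.+2.
Proof. by apply/fintype.subsetP => x; rewrite !inE => /andP[]. Qed.

Lemma card_cofaces y : #|y| = k.+1 -> #|cofaces y| = (n - k.+1)%N.
Proof.
move=> cy; have := card_between (finset.subsetT y).
rewrite setTD (cardsCs (~: y)) setCK card_ord cy => <-.
by apply: eq_card => x; rewrite !inE finset.subsetT andbT.
Qed.

Lemma degree_Ycomplex S y :
  #|[pred x in dfaces (Ycomplex k S) k.+2 | y \subset x]| = #|S :&: cofaces y|.
Proof.
rewrite -cardsE; apply: eq_card => x; rewrite [LHS]inE unfold_in /=.
rewrite -[X in X && _]/(x \in dfaces (Ycomplex k S) k.+2) dfaces_Ycomplex_top !inE.
by case: (x \in S); rewrite ?andbT ?andbF.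
Qed.

Lemma simplex_face_exists m : (m <= n)%N -> exists y, #|y| = m.
Proof.
rewrite -bin_gt0 -card_simplex_faces => /card_gt0P[y].
by rewrite inE => /eqP; exists y.
Qed.

Lemma prY_large_degree : (k.+1 <= n)%N ->
  prY k p (fun Y : complex 'I_n => ~~ ((max_degree Y k)%:R <= (1 + eps) * (n%:R * p)))
  <= 'C(n, k.+1)%:R * expR (- (eps ^+ 2 * (n%:R * p) / 4)).
Proof.
move=> kn; case/andP: p01 => p0 p1; case/andP: eps01 => e0 e1.
(* After [expR l <= 1 + l + l^2] the exponent is at most [l^2 - eps * l] times [n * p]. The choice
   [l = eps / 2] minimizes this, at [- eps^2 / 4], and stays below [1/2] as that bound requires. *)
rewrite prYE; apply: le_trans (bernoulli_pr_bigcup p01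
  (P := fun y => y \in simplex_faces n k.+1)
  (E := fun y S => eps / 2 * ((1 + eps) * (n%:R * p))
    <= eps / 2 * #|S :&: cofaces y|%:R) _) _.
  move=> S SA; rewrite -ltNge => D.
  have : (0 < #|dfaces (Ycomplex k S) k.+1|)%N.
    by rewrite dfaces_Ycomplex_skeleton card_simplex_faces bin_gt0.
  move=> /(eq_bigmax_cond (fun y =>
    #|[pred x in dfaces (Ycomplex k S) k.+2 | y \subset x]|))[y yY Dy].
  exists y; first by rewrite -(dfaces_Ycomplex_skeleton S).
  rewrite ler_pM2l ?divr_gt0 //; apply/ltW; move: D.
  by rewrite /max_degree Dy degree_Ycomplex.
rewrite -card_simplex_faces [leRHS]mulr_natl -sumr_const; apply: ler_sum => y.
rewrite inE => /eqP cy.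
apply: le_trans (bernoulli_pr_chernoff p01 _ _ (cofaces_sub y)) _.
rewrite card_cofaces // ler_expR.
have := @expR_le_quadratic R (eps / 2) ltac:(lra); set e := expR _ => ee.
have : (n - k.+1)%:R * (p * (e - 1)) <= n%:R * p * (eps / 2 + (eps / 2) ^+ 2).
  have e1' : 0 <= e - 1 by rewrite subr_ge0 -[leLHS]expR0 ler_expR; lra.
  rewrite mulrA ler_pM ?mulr_ge0 //; last by lra.
  by rewrite ler_wpM2r // ler_nat leq_subr.
by lra.
Qed.

(** A fixed face has [n - k.+1] cofaces rather than [n]; the deficit costs a factor at most
    [expR k.+1]. *)
Lemma prY_small_degree : (k.+1 <= n)%N ->
  prY k p (fun Y : complex 'I_n => ~~ ((1 - eps) * (n%:R * p) <= (max_degree Y k)%:R))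
  <= expR (k.+1%:R - eps ^+ 2 * (n%:R * p) / 2).
Proof.
move=> kn; case/andP: p01 => p0 p1; case/andP: eps01 => e0 e1.
have [y cy] := simplex_face_exists kn.
(* The union over [unit] only expresses inclusion in a single event. *)
rewrite prYE; apply: le_trans (bernoulli_pr_bigcup p01 (P := fun _ : unit => true)
  (E := fun _ S => (- eps) * ((1 - eps) * (n%:R * p))
    <= (- eps) * #|S :&: cofaces y|%:R) _) _.
  move=> S SA; rewrite -ltNge => D; exists tt => //.
  rewrite ler_nM2l ?oppr_lt0 // (le_trans _ (ltW D)) // ler_nat -degree_Ycomplex.
  have yY : y \in dfaces (Ycomplex k S) k.+1.
    by rewrite dfaces_Ycomplex_skeleton inE cy.
  by rewrite /max_degree (bigD1 y yY) leq_max leqnn.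
rewrite big_const card_unit /= addr0.
apply: le_trans (bernoulli_pr_chernoff p01 _ _ (cofaces_sub y)) _.
rewrite card_cofaces // natrB //.
have -> : (n%:R - k.+1%:R) * (p * (expR (- eps) - 1)) - - eps * ((1 - eps) * (n%:R * p))
   = k.+1%:R * (p * (1 - expR (- eps))) +
     (n%:R * (p * (expR (- eps) - 1)) - - eps * ((1 - eps) * p * n%:R)) by ring.
rewrite !expRD; apply: ler_pM; rewrite ?expR_ge0 ?mulr_ge0 ?expR_ge0 //.
  rewrite ler_expR -[leRHS]mulr1 ler_wpM2l // mulr_ile1 //.
    by rewrite subr_ge0 -[leRHS]expR0 ler_expR oppr_le0 ltW.
by rewrite -expRD; apply: expR_lower_tail; rewrite lexx ler0n.
Qed.
End RandomComplex.

(** * Calculus of asymptotically almost sure events *)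

Section Asymptotics.
Variables (R : realType) (k : nat) (p : nat -> R).
Hypothesis p01 : forall n, 0 <= p n <= 1.
Implicit Types E F G : forall n, complex 'I_n -> bool.

Lemma prY_compl n (E : complex 'I_n -> bool) :
  prY k (p n) E = 1 - prY k (p n) (fun Y => ~~ E Y).
Proof. by rewrite !prYE bernoulli_prC. Qed.

Lemma prY_ge0 n (E : complex 'I_n -> bool) : 0 <= prY k (p n) E.
Proof. by rewrite prYE bernoulli_pr_ge0. Qed.

Lemma aas_of_failure E (u : nat -> R) :
  (\forall n \near \oo, prY k (p n) (fun Y : complex 'I_n => ~~ E n Y) <= u n) ->
  u n @[n --> \oo] --> 0 -> aas k p E.
Proof.
move=> Eu u0; apply: (@squeeze_cvgr _ _ _ _ (fun n => 1 - u n) (cst 1)).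
- apply: filterS Eu => n Eu; rewrite prY_compl lerD2l lerN2 Eu /=.
  by rewrite gerBl prY_ge0.
- by rewrite -[X in _ --> X]subr0; apply: cvgB => //; exact: cvg_cst.
- exact: cvg_cst.
Qed.

Lemma aas_near E :
  (\forall n \near \oo, forall S, E n (Ycomplex k S)) -> aas k p E.
Proof.
move=> nE; apply: (@aas_of_failure _ (cst 0)); last exact: cvg_cst.
apply: filterS nE => n nE; rewrite prYE /bernoulli_pr big1 // => S.
by rewrite nE andbF.
Qed.

(** Union bound for the two failures, indexed by [bool]. *)
Lemma aas_and_imply E F G : aas k p E -> aas k p F ->
  (\forall n \near \oo, forall Y, E n Y -> F n Y -> G n Y) -> aas k p G.
Proof.
move=> aE aF EFG.
pose u n := (1 - prY k (p n) (E n)) + (1 - prY k (p n) (F n)).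
apply: (@aas_of_failure _ u).
  apply: filterS EFG => n EFG.
  rewrite /u (prY_compl (E n)) (prY_compl (F n)) !subKr prYE.
  have := @bernoulli_pr_bigcup R _ (simplex_faces n k.+2) (p n) (p01 n) bool
    predT (fun b S => ~~ (if b then E n else F n) (Ycomplex k S))
    (fun S => ~~ G n (Ycomplex k S)).
  rewrite big_bool /=; apply=> S _ nG.
  case: (boolP (E n (Ycomplex k S))) => [ES|]; last by exists true.
  by exists false => //; apply: contra nG => FS; exact: EFG.
have -> : 0 = (1 - 1) + (1 - 1) :> R by rewrite subrr addr0.
by apply: cvgD; apply: cvgB => //; exact: cvg_cst.
Qed.
End Asymptotics.

(** * Growth of binomial coefficients and decay of the failure bounds *)

Lemma leq_bin_exp n m : ('C(n, m) <= n ^ m)%N.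
Proof.
apply: (@leq_trans (n ^_ m)).
  by rewrite -bin_ffact leq_pmulr ?fact_gt0.
elim: m => // m IH; by rewrite ffactnSr expnSr leq_mul ?leq_subr.
Qed.

(** By Pascal's rule the coefficient grows by at least 1 at each step once [m <= n]. This makes the
    number of [k]-faces diverge. *)
Lemma leq_sub_bin n m : (n - m <= 'C(n, m.+1))%N.
Proof.
elim: n => // n IH; rewrite binS.
have [mn|nm] := leqP m n; last by rewrite (eqP nm).
rewrite subSn // -addn1 leq_add // bin_gt0 //.
Qed.

Lemma cvg_expRN_scaled (R : realType) (w : nat -> R) (c a : R) : 0 < c ->
  w n @[n --> \oo] --> +oo -> expR (a - w n / c) @[n --> \oo] --> 0.
Proof.
move=> c0 wy.
have cwy : w n / c @[n --> \oo] --> +oo.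
  apply/cvgryPge => A; apply: filterS (cvgry_ge wy (A * c)) => n.
  by rewrite ler_pdivlMr.
under eq_fun do rewrite expRD.
rewrite -(mulr0 (expR a)); apply: cvgM; first exact: cvg_cst.
exact: (cvg_comp _ _ cwy (@cvgr_expR R)).
Qed.

Lemma bin_le_expR (R : realType) n m : (0 < n)%N ->
  'C(n, m)%:R <= expR (m%:R * ln n%:R) :> R.
Proof.
move=> n0; rewrite expRM_natl lnK ?posrE ?ltr0n // -natrX ler_nat.
exact: leq_bin_exp.
Qed.

Theorem corollary5p2 (R : realType) (k : nat) (eps : R) (omega p : nat -> R)
    (heps : 0 < eps < 1)
    (homega : omega n @[n --> \oo] --> +oo)
    (hp01 : forall n, 0 <= p n <= 1)
    (hp : \forall n \near \oo,
       (2 * k.+1%:R * k.+2%:R * ln n%:R + omega n) / (eps ^+ 2 * n%:R) <= p n) :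
  [/\ aas k p (fun n Y =>
        (1 - eps) * p n * (n%:R / k.+2%:R) <= expansion R Y k),
      aas k p (fun n Y =>
        `|(max_degree Y k)%:R - n%:R * p n| <= eps * (n%:R * p n)) &
      aas_degree_relative_expander k p].
Proof.
have [e0 e1] := andP heps.
(* The hypothesis on [p], cleared of a denominator that is positive for these [n]. *)
have X_ge : \forall n \near \oo, (k.+2 <= n)%N /\
    2 * k.+1%:R * k.+2%:R * ln n%:R + omega n <= eps ^+ 2 * (n%:R * p n).
  apply: filterS2 (nbhs_infty_ge k.+2) hp => n kn hpn; split => //.
  have en0 : 0 < eps ^+ 2 * n%:R.
    by rewrite mulr_gt0 ?exprn_gt0 // ltr0n; exact: leq_trans kn.
  by move: hpn; rewrite (ler_pdivrMr _ _ en0) (mulrC (p n)) mulrA.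
have ln0 n : (k.+2 <= n)%N -> 0 <= ln (n%:R : R).
  by move=> kn; rewrite ln_ge0 // ler1n; exact: leq_trans kn.
have np_gt0 : \forall n \near \oo, 0 < n%:R * p n.
  apply: filterS2 X_ge (cvgry_ge homega 1) => n [/ln0 lnn X1] w1.
  rewrite -(pmulr_rgt0 _ (exprn_gt0 2 e0)); apply: lt_le_trans X1.
  by rewrite ltr_wpDl ?mulr_ge0 // (lt_le_trans ltr01).
have small_expansion : aas k p (fun n Y =>
    (1 - eps) * p n * (n%:R / k.+2%:R) <= expansion R Y k).
  (* The constant [2 (k+1) (k+2)] makes [eps^2 n p / (2 (k+2))] absorb exactly the [(k+1) ln n]
     coming from the number of [k]-faces; only [omega] remains. *)
  apply: (@aas_of_failure _ _ _ hp01 _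
    (fun n => expR (expR (0 - omega n / (2 * k.+2%:R))) - 1)).
    apply: filterS X_ge => n [kn X1].
    apply: le_trans (prY_small_expansion (hp01 n) heps kn) _.
    rewrite lerD2r ler_expR.
    apply: le_trans (ler_wpM2r (expR_ge0 _) (bin_le_expR _ _ _)) _.
      exact: leq_trans kn.
    rewrite -expRD ler_expR sub0r -subr_ge0 opprD opprK.
    rewrite [leRHS](_ : _ = (eps ^+ 2 * (n%:R * p n) -
      (2 * k.+1%:R * k.+2%:R * ln n%:R + omega n)) / (2 * k.+2%:R)).
      by rewrite divr_ge0 ?subr_ge0.
    have : k.+2%:R != 0 :> R by rewrite pnatr_eq0.
    by move: (k.+2%:R : R) (k.+1%:R : R) => a b a0; field.
  rewrite -[X in _ --> X](subrr 1) -[X in _ --> X - _](@expR0 R).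
  apply: cvgB; last exact: cvg_cst.
  apply: (cvg_comp _ _ (cvg_expRN_scaled _ _ homega)); first by rewrite mulr_gt0.
  exact: continuous_expR.
have large_degree : aas k p (fun n Y =>
    (max_degree Y k)%:R <= (1 + eps) * (n%:R * p n)).
  apply: (@aas_of_failure _ _ _ hp01 _ (fun n => expR (0 - omega n / 4))).
    apply: filterS X_ge => n [kn X1].
    apply: le_trans (prY_large_degree (hp01 n) heps (ltnW kn)) _.
    apply: le_trans (ler_wpM2r (expR_ge0 _) (bin_le_expR _ _ _)) _.
      exact: leq_trans kn.
    rewrite -expRD ler_expR.
    (* Here the logarithm is absorbed with a factor [(k+2) / 2 >= 1] to spare. *)
    have : k.+1%:R * ln n%:R <= k.+1%:R * ln n%:R * (k.+2%:R / 2) :> R.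
      by rewrite ler_peMr ?mulr_ge0 ?ln0 // ler_pdivlMr // mul1r ler_nat.
    by lra.
  exact: cvg_expRN_scaled.
have small_degree : aas k p (fun n Y =>
    (1 - eps) * (n%:R * p n) <= (max_degree Y k)%:R).
  apply: (@aas_of_failure _ _ _ hp01 _ (fun n => expR (k.+1%:R - omega n / 2))).
    apply: filterS X_ge => n [kn X1].
    apply: le_trans (prY_small_degree (hp01 n) heps (ltnW kn)) _.
    rewrite ler_expR.
    have : 0 <= 2 * k.+1%:R * k.+2%:R * ln n%:R :> R by rewrite !mulr_ge0 ?ln0.
    by lra.
  exact: cvg_expRN_scaled.
have degree : aas k p (fun n Y =>
    `|(max_degree Y k)%:R - n%:R * p n| <= eps * (n%:R * p n)).
  apply: (aas_and_imply hp01 small_degree large_degree).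
  by apply: nearW => n Y lo hi; rewrite ler_norml; apply/andP; split; lra.
split => //; split=> [M|].
  apply: aas_near => //; apply: filterS (nbhs_infty_ge (M + k)) => n Mn S.
  rewrite dfaces_Ycomplex_skeleton card_simplex_faces.
  by apply: leq_trans (leq_sub_bin n k); rewrite leq_subRL ?(addnC k) //;
    exact: leq_trans (leq_addl _ _) Mn.
(* The lower bound for the expansion divided by the upper bound [(1 + eps) n p] for the degree. *)
exists ((1 - eps) / (k.+2%:R * (1 + eps))).
  by rewrite divr_gt0 ?mulr_gt0 //; lra.
apply: (aas_and_imply hp01 small_expansion degree).
apply: filterS np_gt0 => n np0 Y hY; rewrite ler_norml => /andP[lo hi].
(* The lower tail excludes degree 0, where the quotient would be 0 by convention. *)
have D0 : 0 < (max_degree Y k)%:R :> R by nra.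
rewrite ler_pdivlMr //; apply: le_trans hY.
apply: (@le_trans _ _ ((1 - eps) / (k.+2%:R * (1 + eps)) * ((1 + eps) * (n%:R * p n)))).
  apply: ler_wpM2l; last by lra.
  by rewrite divr_ge0 ?mulr_ge0 //; lra.
have : k.+2%:R != 0 :> R by rewrite pnatr_eq0.
have : 1 + eps != 0 by apply: lt0r_neq0; lra.
move: (k.+2%:R : R) => a eps1 a0.
by rewrite le_eqVlt; apply/orP; left; apply/eqP; field; rewrite eps1 a0.
Qed.
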